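(* Let $K=(K_{j,k})_{j,k\in\mathbb{N}_0}$ be a non-negative symmetric interaction kernel satisfying $K_{j,k}\le Cj^2k^2$ for all $(j,k)\in\mathbb{N}_0\times\mathbb{N}_0$, where $C>0$. Let $f(0)=(f_j(0))_{j\ge0}\in Y_2^+$ with $M_2(f(0))>0$. Then for every $T_0$ with $0<T_0<\left(2M_2(f(0))C\right)^{-1}$, the EDG system with kernel $K$ and initial data $f(0)$ has a continuously differentiable solution $(f_j)_{j\ge0}$ on $[0,T_0]$ with values in $Y_2^+$, satisfying $$M_0(f(t))=M_0(f(0))\quad\text{and}\quad M_1(f(t))=M_1(f(0))\qquad\text{for all } t\in[0,T_0].$$
   Context: $\mathbb{N}=\{1,2,\dots\}$, $\mathbb{N}_0=\mathbb{N}\cup\{0\}$. $Y_2^+$ is the set of sequences $f=(f_j)_{j\ge0}$ of non-negative reals with $\sum_{j\ge0}j^2f_j<\infty$. $M_p(f)=\sum_{j\ge0}j^pf_j$ for $p>0$ and $M_0(f)=\sum_{j\ge0}f_j$. Symmetric means $K_{j,k}=K_{k,j}$. The exchange-driven growth (EDG) system with kernel $K$ is $$\dot f_j=f_{j+1}\sum_{k=0}^\infty K_{j+1,k}f_k-f_j\sum_{k=0}^\infty K_{j,k}f_k-f_j\sum_{k=1}^\infty K_{k,j}f_k+f_{j-1}\sum_{k=1}^\infty K_{k,j-1}f_k\quad(j\in\mathbb{N}),$$ $$\dot f_0=f_1\sum_{k=0}^\infty K_{1,k}f_k-f_0\sum_{k=1}^\infty K_{k,0}f_k,$$ with prescribed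 initial data $f_j(0)$, $j\in\mathbb{N}_0$. A continuously differentiable solution is one for which each $f_j$ is continuously differentiable and the equations hold pointwise in time. *)

(* Defs.v *)
From Stdlib Require Import Reals.
From Coquelicot Require Import Coquelicot.
Open Scope R_scope.

(* Coquelicot's [Series] is total: it is the sum only when the series
   converges.  Hence convergence is required explicitly in [Y2plus] and in
   [EDG_summable]. *)

Definition Y2plus (f : nat -> R) : Prop :=
  (forall j, 0 <= f j) /\ ex_series (fun j => INR j ^ 2 * f j).

(* Since [0 ^ 0 = 1], [M 0 f] is the sum of all [f j], including [f 0]. *)
Definition M (p : nat) (f : nat -> R) : R :=
  Series (fun j => INR j ^ p * f j).

Definition EDG_summable (K : nat -> nat -> R) (f : nat -> R) : Prop :=
  forall j, ex_series (fun k => K j k * f k)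
         /\ ex_series (fun k => K (S k) j * f (S k)).

(* Sums over k >= 1 are written with the index shift k = S k'. *)
Definition EDG_rhs (K : nat -> nat -> R) (f : nat -> R) (j : nat) : R :=
  match j with
  | O =>
      f 1%nat * Series (fun k => K 1%nat k * f k)
      - f O * Series (fun k => K (S k) O * f (S k))
  | S i =>
      f (S j) * Series (fun k => K (S j) k * f k)
      - f j * Series (fun k => K j k * f k)
      - f j * Series (fun k => K (S k) j * f (S k))
      + f i * Series (fun k => K (S k) i * f (S k))
  end.

(* [is_derive] with the neighbourhoods of [t] restricted to [D]: for [D] a
   closed interval this is the one-sided derivative at the endpoints, and the
   values of [g] outside [D] are irrelevant. *)
Definition is_derive_on (D : R -> Prop) (g : R -> R) (t l : R) : Prop :=
  filterdiff g (within D (locally t)) (fun h => scal h l).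

Definition C1_on (D : R -> Prop) (g : R -> R) : Prop :=
  exists dg : R -> R,
    (forall t, D t -> is_derive_on D g t (dg t)) /\ continuous_on D dg.

Definition EDG_C1_solution (K : nat -> nat -> R) (f0 : nat -> R) (T : R)
    (f : R -> nat -> R) : Prop :=
  let D := fun t => 0 <= t <= T in
  (forall j, f 0 j = f0 j)
  /\ (forall j, C1_on D (fun t => f t j))
  /\ (forall t, D t -> EDG_summable K (f t))
  /\ (forall t j, D t -> is_derive_on D (fun s => f s j) t (EDG_rhs K (f t) j)).

(* Main.v *)
(* Since the kernel is symmetric and [K j 0 = 0], the right-hand side is the discrete
   Laplacian of the flux [a_j = f_j * sum_k K_{j,k} f_k].  Summation by parts
   conserves [M 0] and [M 1] and gives [M2' = 2 sum_j a_j <= 2 C M2^2], which stays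
   bounded before time [1 / (2 C M2(0))].  Kernel-truncated explicit Euler schemes obey the
   same estimates, are uniformly Lipschitz in time, and, by testing with the weights
   [min (k^2, k^3 / m)], have uniformly small second-moment tails.  Hence a pointwise
   limit of the schemes along a suitable filter conserves [M 0] and [M 1], and its fluxes
   are the limits of the discrete fluxes.  These are equicontinuous in time, so
   that the limit satisfies the equations directly in differential form. *)

Require Import Defs.
From Stdlib Require Import Reals ZArith Psatz Classical Cantor.
From Coquelicot Require Import Coquelicot.
Open Scope R_scope.

(** * Discrete Laplacian and weighted partial sums *)

(** The obstacle is that [K j k] may grow like [k^2] in [k]. A second-moment bound then makes the
    rates [sum_k K j k * f k] finite, but second-moment mass could still escape to infinity and be
    lost in the limit. The sharp tail weight [tail_sq m] cannot be propagated: its second difference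
    at [m - 1] is [m^2], where the weight itself vanishes. A usable weight must satisfy
    [k^2 lap w <= c w]. Both [k^2] and [k^3] do, and a minimum of two such weights inherits the
    property. Explicit Euler takes the place of any ODE theory. A step below the inverse of the
    largest rate keeps the entries non-negative. The majorant of the second moment is convex, so
    Euler values stay below it and no lifespan is lost. Tying the step to the truncation [n] leaves
    a single limit. Index 0 carries no second moment, so nothing bounds [f 0] through it. Since
    [K 0 k = 0], its flux vanishes, and conditions on weights therefore start at index 1. *)

Definition lap (a : nat -> R) (j : nat) : R :=
  match j with
  | O => a 1%nat - 2 * a O
  | S i => a (S j) - 2 * a j + a i
  end.

Definition wsum (n : nat) (w f : nat -> R) : R :=
  sum_f_R0 (fun k => w k * f k) n.

Definition sq (k : nat) : R := INR k ^ 2.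

Lemma sq_nonneg (k : nat) : 0 <= sq k.
Proof. unfold sq; apply pow2_ge_0. Qed.

Lemma sq_ge_1 (k : nat) : (1 <= k)%nat -> 1 <= sq k.
Proof.
  intros Hk. apply le_INR in Hk. simpl in Hk. unfold sq. nra.
Qed.

Lemma wsum_S n w f : wsum (S n) w f = wsum n w f + w (S n) * f (S n).
Proof. reflexivity. Qed.

Lemma wsum_le n w w' f :
  (forall k, 0 <= f k) -> (forall k, w k <= w' k) -> wsum n w f <= wsum n w' f.
Proof.
  intros Hf Hw. apply sum_Rle. intros k _. apply Rmult_le_compat_r; auto.
Qed.

Lemma wsum_nonneg n w f :
  (forall k, 0 <= f k) -> (forall k, 0 <= w k) -> 0 <= wsum n w f.
Proof. intros Hf Hw. apply cond_pos_sum. intros k. now apply Rmult_le_pos. Qed.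

Lemma wsum_term_le n w f k :
  (forall k, 0 <= f k) -> (forall k, 0 <= w k) -> (k <= n)%nat ->
  w k * f k <= wsum n w f.
Proof.
  intros Hf Hw. induction n as [|n IH]; intros Hk.
  - replace k with O by lia. apply Rle_refl.
  - rewrite wsum_S. pose proof (Rmult_le_pos _ _ (Hw (S n)) (Hf (S n))).
    destruct (Nat.eq_dec k (S n)) as [->|Hne].
    + pose proof (wsum_nonneg n w f Hf Hw). lra.
    + specialize (IH ltac:(lia)). lra.
Qed.

Lemma wsum_incr m n w f :
  (m <= n)%nat -> (forall k, 0 <= f k) -> (forall k, 0 <= w k) ->
  wsum m w f <= wsum n w f.
Proof.
  intros Hmn Hf Hw. induction Hmn as [|n _ IH]; [apply Rle_refl|].
  rewrite wsum_S. pose proof (Rmult_le_pos _ _ (Hw (S n)) (Hf (S n))). lra.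
Qed.

Lemma wsum_scal n w f c : wsum n (fun k => c * w k) f = c * wsum n w f.
Proof.
  unfold wsum. rewrite scal_sum. apply sum_eq. intros; ring.
Qed.

Lemma wsum_add_r n w f g c :
  wsum n w (fun k => f k + c * g k) = wsum n w f + c * wsum n w g.
Proof.
  unfold wsum. rewrite scal_sum, <- sum_plus. apply sum_eq. intros; ring.
Qed.

Lemma wsum_dist n w f g d :
  (forall k, 0 <= w k) -> (forall k, (k <= n)%nat -> Rabs (f k - g k) <= d) ->
  Rabs (wsum n w f - wsum n w g) <= d * sum_f_R0 w n.
Proof.
  intros Hw. induction n as [|n IH]; intros Hd.
  - unfold wsum; simpl. replace (w O * f O - w O * g O) with (w O * (f O - g O)) by ring.
    rewrite Rabs_mult, (Rabs_pos_eq _ (Hw O)).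
    specialize (Hd O (le_n _)). specialize (Hw O). nra.
  - rewrite !wsum_S. simpl sum_f_R0.
    replace (wsum n w f + w (S n) * f (S n) - (wsum n w g + w (S n) * g (S n)))
      with ((wsum n w f - wsum n w g) + w (S n) * (f (S n) - g (S n))) by ring.
    eapply Rle_trans; [apply Rabs_triang|].
    rewrite Rabs_mult, (Rabs_pos_eq _ (Hw (S n))).
    assert (IH' : Rabs (wsum n w f - wsum n w g) <= d * sum_f_R0 w n)
      by (apply IH; intros; apply Hd; lia).
    specialize (Hd (S n) (le_n _)). specialize (Hw (S n)). nra.
Qed.

(** At 0, [lap] extends sequences by 0 to index -1, so it is symmetric there and boundary terms
    arise at the upper end only. They involve just [a n] and [a (S n)]. *)
Lemma wsum_lap n w a :
  wsum n w (lap a) = wsum n (lap w) a + w n * a (S n) - w (S n) * a n.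
Proof.
  induction n as [|n IH]; [unfold wsum; simpl; ring|].
  rewrite !wsum_S, IH. simpl. ring.
Qed.

Lemma wsum_le_Series n w f :
  (forall k, 0 <= f k) -> (forall k, 0 <= w k) -> ex_series (fun k => w k * f k) ->
  wsum n w f <= Series (fun k => w k * f k).
Proof.
  intros Hf Hw Hex. unfold wsum. rewrite <- sum_n_Reals.
  apply (is_lim_seq_incr_compare (sum_n (fun k => w k * f k))).
  - exact (Series_correct _ Hex).
  - intros m. rewrite sum_Sn. unfold plus; simpl.
    pose proof (Rmult_le_pos _ _ (Hw (S m)) (Hf (S m))). lra.
Qed.

(** A single term does not affect convergence, so [w 0] is left free. This admits the constant
    weight 1, which exceeds [c * sq 0 = 0]. *)
Lemma ex_series_wsum w f c : Y2plus f ->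
  (forall k, (1 <= k)%nat -> 0 <= w k <= c * sq k) -> ex_series (fun k => w k * f k).
Proof.
  intros [Hf Hex] Hw. apply ex_series_incr_1.
  apply (ex_series_le (K := R_AbsRing) (V := R_CompleteNormedModule) _
    (fun k => c * (INR (S k) ^ 2 * f (S k)))).
  - intros k. change (Rabs (w (S k) * f (S k)) <= c * (INR (S k) ^ 2 * f (S k))).
    destruct (Hw (S k) ltac:(lia)) as [H1 H2]. specialize (Hf (S k)).
    rewrite Rabs_pos_eq by now apply Rmult_le_pos.
    rewrite <- Rmult_assoc. now apply Rmult_le_compat_r.
  - apply (ex_series_scal_l (K := R_AbsRing) (V := R_NormedModule) c).
    exact (proj1 (ex_series_incr_1 (fun k => INR k ^ 2 * f k)) Hex).
Qed.

Definition tail_sq (m k : nat) : R := if Nat.leb m k then sq k else 0.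

Lemma tail_sq_nonneg m k : 0 <= tail_sq m k.
Proof. unfold tail_sq. destruct (Nat.leb m k); [apply sq_nonneg | lra]. Qed.

Lemma wsum_tail_le m n w f c :
  (m <= n)%nat -> (forall k, 0 <= f k) -> 0 <= c ->
  (forall k, (1 <= k)%nat -> 0 <= w k <= c * sq k) ->
  Rabs (wsum n w f - wsum m w f) <= c * wsum n (tail_sq m) f.
Proof.
  intros Hmn Hf Hc Hw. induction Hmn as [|n Hmn IH].
  - rewrite Rminus_diag, Rabs_R0. apply Rmult_le_pos; [assumption|].
    apply wsum_nonneg; [assumption|]. apply tail_sq_nonneg.
  - rewrite !wsum_S. unfold tail_sq at 2. rewrite (proj2 (Nat.leb_le m (S n))) by lia.
    replace (wsum n w f + w (S n) * f (S n) - wsum m w f)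
      with (wsum n w f - wsum m w f + w (S n) * f (S n)) by ring.
    eapply Rle_trans; [apply Rabs_triang|].
    destruct (Hw (S n) ltac:(lia)) as [H1 H2]. specialize (Hf (S n)).
    rewrite (Rabs_pos_eq (w (S n) * f (S n))) by nra. nra.
Qed.

(** * The tail weights *)

(* Below [m] this weight has a factor [k / m], so it is small on a fixed head of
   the sequence, yet it dominates [tail_sq m] and obeys [k^2 lap w <= 6 w]
   uniformly in [m]. *)
Definition cutoff (m k : nat) : R := Rmin (INR k ^ 2) (INR k ^ 3 / INR m).

Lemma cutoff_nonneg m k : (1 <= m)%nat -> 0 <= cutoff m k.
Proof.
  intros Hm. apply le_INR in Hm; simpl in Hm. pose proof (pos_INR k).
  apply Rmin_glb; [nra|]. apply Rdiv_le_0_compat; [apply pow_le; assumption|lra].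
Qed.

Lemma cutoff_above m k : (1 <= m)%nat -> (m <= k)%nat -> cutoff m k = INR k ^ 2.
Proof.
  intros Hm Hk. apply le_INR in Hm, Hk; simpl in Hm. apply Rmin_left.
  apply Rmult_le_reg_r with (INR m); [lra|].
  unfold Rdiv. rewrite Rmult_assoc, Rinv_l by lra.
  assert (0 <= INR k ^ 2) by (apply pow2_ge_0). simpl in *. nra.
Qed.

Lemma cutoff_below m k : (1 <= m)%nat -> (k <= m)%nat -> cutoff m k = INR k ^ 3 / INR m.
Proof.
  intros Hm Hk. apply le_INR in Hm, Hk; simpl in Hm. apply Rmin_right.
  apply Rmult_le_reg_r with (INR m); [lra|].
  unfold Rdiv. rewrite Rmult_assoc, Rinv_l by lra.
  assert (0 <= INR k ^ 2) by (apply pow2_ge_0). simpl in *. nra.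
Qed.

Lemma tail_sq_le_cutoff m k : (1 <= m)%nat -> tail_sq m k <= cutoff m k.
Proof.
  intros Hm. unfold tail_sq. destruct (Nat.leb m k) eqn:E.
  - apply Nat.leb_le in E. rewrite cutoff_above by assumption. apply Rle_refl.
  - now apply cutoff_nonneg.
Qed.

(** Below [J] the cubic branch is [k / m] times [sq k]; from [J] on the quadratic branch suffices.
    Choosing first [J] and then [m] large makes both contributions small. *)
Lemma cutoff_le m J k : (1 <= m)%nat -> (1 <= J)%nat ->
  cutoff m k <= INR J / INR m * sq k + tail_sq J k.
Proof.
  intros Hm HJ. pose proof (le_INR _ _ Hm) as Hm'; simpl in Hm'.
  pose proof (le_INR _ _ HJ) as HJ'; simpl in HJ'. pose proof (sq_nonneg k).
  assert (0 <= INR J / INR m) by (apply Rdiv_le_0_compat; lra).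
  unfold tail_sq. destruct (Nat.leb J k) eqn:E.
  - assert (cutoff m k <= sq k) by apply Rmin_l. nra.
  - apply Nat.leb_gt in E. assert (E' : INR k <= INR J) by (apply le_INR; lia).
    eapply Rle_trans; [apply Rmin_r|]. rewrite Rplus_0_r.
    apply Rle_trans with (INR k / INR m * sq k).
    + apply Req_le. unfold sq. field. lra.
    + apply Rmult_le_compat_r; [assumption|]. apply Rmult_le_compat_r; [|assumption].
      left. apply Rinv_0_lt_compat. lra.
Qed.

(** The minimum is attained at [j] by one branch; using that branch at both neighbours as well can
    only increase the second difference. The cubic branch has second difference [6 * j / m], which
    gives equality with constant 6; the quadratic one has 2. *)
Lemma sq_lap_cutoff_le m j : (1 <= m)%nat -> (1 <= j)%nat ->
  sq j * lap (cutoff m) j <= 6 * cutoff m j.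
Proof.
  intros Hm Hj. destruct j as [|i]; [lia|].
  pose proof (le_INR _ _ Hm) as Hm'; simpl in Hm'.
  assert (Hi := pos_INR i). unfold lap.
  destruct (Nat.le_gt_cases (S i) m) as [Hle|Hgt].
  - rewrite (cutoff_below m (S i)) by assumption.
    assert (H1 : cutoff m (S (S i)) <= INR (S (S i)) ^ 3 / INR m) by apply Rmin_r.
    assert (H2 : cutoff m i <= INR i ^ 3 / INR m) by apply Rmin_r.
    apply Rle_trans with
      (sq (S i) * (INR (S (S i)) ^ 3 / INR m - 2 * (INR (S i) ^ 3 / INR m) + INR i ^ 3 / INR m)).
    + apply Rmult_le_compat_l; [apply sq_nonneg | lra].
    + unfold sq. rewrite !S_INR. apply Req_le. field. lra.
  - rewrite (cutoff_above m (S i)) by lia.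
    assert (H1 : cutoff m (S (S i)) <= INR (S (S i)) ^ 2) by apply Rmin_l.
    assert (H2 : cutoff m i <= INR i ^ 2) by apply Rmin_l.
    apply Rle_trans with
      (sq (S i) * (INR (S (S i)) ^ 2 - 2 * (INR (S i) ^ 2) + INR i ^ 2)).
    + apply Rmult_le_compat_l; [apply sq_nonneg | lra].
    + unfold sq. rewrite !S_INR. nra.
Qed.

Lemma wsum_tail_sq J n f :
  (J <= n)%nat -> wsum n (tail_sq (S J)) f = wsum n sq f - wsum J sq f.
Proof.
  intros Hn. induction Hn as [|n Hn IH].
  - rewrite Rminus_diag. apply sum_eq_R0. intros k Hk. unfold tail_sq.
    rewrite (proj2 (Nat.leb_gt (S J) k)) by lia. ring.
  - rewrite !wsum_S, IH. unfold tail_sq.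
    rewrite (proj2 (Nat.leb_le (S J) (S n))) by lia. ring.
Qed.

Lemma tail_sq_small (f : nat -> R) : Y2plus f ->
  forall eps, 0 < eps -> exists J, (1 <= J)%nat /\ forall n, wsum n (tail_sq J) f <= eps.
Proof.
  intros [Hf Hex] eps Heps.
  destruct (proj1 (is_series_Reals _ _) (Series_correct _ Hex) eps Heps) as [J HJ].
  specialize (HJ J (le_n _)). apply Rabs_def2 in HJ. destruct HJ as [_ HJ].
  exists (S J). split; [lia|]. intros n.
  apply Rle_trans with (wsum (max J n) (tail_sq (S J)) f).
  - apply wsum_incr; [lia|assumption|apply tail_sq_nonneg].
  - rewrite wsum_tail_sq by lia.
    pose proof (wsum_le_Series (max J n) sq f Hf sq_nonneg Hex) as H.
    unfold wsum, sq in *. lra.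
Qed.

Lemma cutoff_wsum_small (f : nat -> R) : Y2plus f ->
  forall eps, 0 < eps -> exists m, (1 <= m)%nat /\ forall n, wsum n (cutoff m) f <= eps.
Proof.
  intros HY eps Heps. assert (Heps2 : 0 < eps / 2) by lra.
  destruct (tail_sq_small f HY _ Heps2) as [J [HJ Htail]]. destruct HY as [Hf Hex].
  set (S2 := Series (fun j => INR j ^ 2 * f j)).
  destruct (INR_unbounded (2 * (INR J * S2) / eps)) as [m0 Hm0].
  exists (S m0). split; [lia|]. intros n.
  assert (Hm : 2 * (INR J * S2) / eps < INR (S m0)) by (rewrite S_INR; lra).
  assert (Hmp : 0 < INR (S m0)) by (apply lt_0_INR; lia).
  apply Rle_trans with (wsum n (fun k => INR J / INR (S m0) * sq k + tail_sq J k) f).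
  - apply wsum_le; [assumption|]. intros k. apply cutoff_le; lia.
  - replace (wsum n (fun k => INR J / INR (S m0) * sq k + tail_sq J k) f)
      with (INR J / INR (S m0) * wsum n sq f + wsum n (tail_sq J) f).
    2:{ unfold wsum. rewrite scal_sum, <- sum_plus. apply sum_eq. intros; ring. }
    specialize (Htail n).
    assert (INR J / INR (S m0) * wsum n sq f <= eps / 2); [|lra].
    apply Rle_trans with (INR J / INR (S m0) * S2).
    + apply Rmult_le_compat_l.
      * apply Rdiv_le_0_compat; [apply pos_INR|assumption].
      * apply (wsum_le_Series n sq f Hf sq_nonneg Hex).
    + apply Rmult_le_reg_r with (INR (S m0)); [assumption|].
      replace (INR J / INR (S m0) * S2 * INR (S m0)) with (INR J * S2) by (field; lra).
      apply Rmult_lt_compat_r with (r := eps / 2) in Hm; [|lra].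
      replace (2 * (INR J * S2) / eps * (eps / 2)) with (INR J * S2) in Hm by (field; lra).
      lra.
Qed.

(** * Limits along a countably deciding filter *)

Definition infinitely_often (P : nat -> Prop) : Prop :=
  forall N, exists n, (N <= n)%nat /\ P n.

(** Nested selection as in the Bolzano-Weierstrass theorem: stage [i] keeps the indices with [Q i]
    if infinitely many remain, and otherwise those without it. The equivalence covers both cases
    without a choice function. *)
Fixpoint decided (Q : nat -> nat -> Prop) (i : nat) : nat -> Prop :=
  match i with
  | O => fun _ => True
  | S i => fun n => decided Q i n /\
      (infinitely_often (fun n => decided Q i n /\ Q i n) <-> Q i n)
  end.

Lemma decided_infinite Q i : infinitely_often (decided Q i).
Proof.
  induction i as [|i IH]; [intros N; exists N; split; [lia|exact I]|].
  destruct (classic (infinitely_often (fun n => decided Q i n /\ Q i n))) as [H|H].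
  - intros N. destruct (H N) as [n [Hn [H1 H2]]]. exists n. simpl. tauto.
  (* Beyond [N'] every surviving index fails [Q i], so the complement retains infinitely many. *)
  - intros N. assert (H' := H). apply not_all_ex_not in H'. destruct H' as [N' HN'].
    destruct (IH (max N N')) as [n [Hn Hd]]. exists n. split; [lia|]. simpl.
    split; [assumption|]. split; [tauto|]. intros HQ. exfalso. apply HN'.
    exists n. split; [lia|tauto].
Qed.

Lemma decided_mono Q i j n : (i <= j)%nat -> decided Q j n -> decided Q i n.
Proof. intros H. induction H as [|j _ IH]; [auto|]. simpl. tauto. Qed.

(* A filter that decides countably many predicates is enough to replace the
   subsequence produced by a diagonal argument. *)
Lemma deciding_filter (Q : nat -> nat -> Prop) :
  exists U : (nat -> Prop) -> Prop,
    ProperFilter U /\ filter_le U eventually /\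
    forall i, U (Q i) \/ U (fun n => ~ Q i n).
Proof.
  exists (fun A => exists i N, forall n, (N <= n)%nat -> decided Q i n -> A n).
  split; [|split].
  - constructor; [|constructor].
    + intros P [i [N H]]. destruct (decided_infinite Q i N) as [n [Hn Hd]].
      exists n. auto.
    + exists O, O. auto.
    + intros P R [i [N HP]] [j [N' HR]]. exists (max i j), (max N N'). intros n Hn Hd.
      split; [apply HP|apply HR]; try lia; eapply decided_mono; try eassumption; lia.
    + intros P R HPR [i [N HP]]. exists i, N. auto.
  - intros P [N HN]. exists O, N. auto.
  - intros i. destruct (classic (infinitely_often (fun n => decided Q i n /\ Q i n))) as [H|H].
    + left. exists (S i), O. simpl. tauto.
    + right. exists (S i), O. simpl. tauto.
Qed.

(** Cauchy criterion: descending through the thresholds [k / (l + 1)] from one above [b], the first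
    that [U] decides negatively confines [u] to a cell of width [1 / (l + 1)]. If none does,
    non-negativity of [u] confines it to the lowest cell. *)
Lemma bounded_decided_lim (U : (nat -> Prop) -> Prop) (u : nat -> R) (b : R) :
  ProperFilter U -> U (fun n => 0 <= u n <= b) ->
  (forall k l : nat, U (fun n => u n <= INR k / INR (S l)) \/
                     U (fun n => ~ u n <= INR k / INR (S l))) ->
  exists l : R, filterlim u U (locally l).
Proof.
  intros HU Hb Hdec.
  apply (filterlim_locally_cauchy (U := R_CompleteSpace)). intros eps.
  destruct (INR_unbounded (/ eps)) as [l Hl].
  assert (Hl' : / INR (S l) < eps).
  { assert (0 < / eps) by (apply Rinv_0_lt_compat, cond_pos).
    rewrite <- (Rinv_inv eps). rewrite S_INR.
    apply Rinv_lt_contravar; [apply Rmult_lt_0_compat|]; lra. }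
  assert (Hpos : 0 < INR (S l)) by (apply lt_0_INR; lia).
  assert (Hk : forall k, U (fun n => u n <= INR k / INR (S l)) ->
     exists k, U (fun n => INR k / INR (S l) <= u n <= INR (S k) / INR (S l))).
  { induction k as [|k IH]; intros H.
    - exists O. generalize (filter_and _ _ Hb H). apply filter_imp.
      intros n [[H1 H2] H3]. simpl INR at 1. unfold Rdiv at 1. rewrite Rmult_0_l.
      split; [assumption|]. eapply Rle_trans; [exact H3|].
      apply Rmult_le_compat_r; [left; now apply Rinv_0_lt_compat|]. apply le_INR; lia.
    - destruct (Hdec k l) as [Hd|Hd]; [now apply IH|]. exists k.
      generalize (filter_and _ _ Hd H). apply filter_imp. intros n [H1 H2].
      split; [lra|assumption]. }
  destruct (INR_unbounded (b * INR (S l))) as [k0 Hk0].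
  destruct (Hk k0) as [k HUk].
  { generalize Hb. apply filter_imp. intros n [_ H]. eapply Rle_trans; [exact H|].
    apply Rmult_le_reg_r with (INR (S l)); [assumption|].
    replace (INR k0 / INR (S l) * INR (S l)) with (INR k0) by (field; lra). lra. }
  eexists. split; [exact HUk|]. intros p q Hp Hq. cbv beta in Hp, Hq.
  assert (INR (S k) / INR (S l) = INR k / INR (S l) + / INR (S l))
    by (rewrite (S_INR k); field; lra).
  change (Rabs (u q - u p) < eps).
  apply Rabs_def1; lra.
Qed.

Lemma diagonal_filter (u : nat -> nat -> R) :
  (forall i, exists b, eventually (fun n => 0 <= u i n <= b)) ->
  exists U : (nat -> Prop) -> Prop,
    ProperFilter U /\ filter_le U eventually /\
    forall i, exists l : R, filterlim (u i) U (locally l).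
Proof.
  intros Hb.
  destruct (deciding_filter (fun c n =>
     let (i, kl) := of_nat c in let (k, l) := of_nat kl in
     u i n <= INR k / INR (S l))) as [U [HU [Hle Hdec]]].
  exists U. split; [assumption|]. split; [assumption|]. intros i.
  destruct (Hb i) as [b Hbi]. apply (bounded_decided_lim U (u i) b HU (Hle _ Hbi)).
  intros k l. specialize (Hdec (to_nat (i, to_nat (k, l)))).
  rewrite !cancel_of_to in Hdec. exact Hdec.
Qed.

Section FilterLimits.

Variable U : (nat -> Prop) -> Prop.
Context {U_proper : ProperFilter U}.

Lemma filterlim_R (u : nat -> R) (l : R) :
  filterlim u U (locally l) <-> (forall eps, 0 < eps -> U (fun n => Rabs (u n - l) < eps)).
Proof.
  rewrite filterlim_locally. split.
  - intros H eps Heps. exact (H (mkposreal eps Heps)).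
  - intros H eps. exact (H eps (cond_pos eps)).
Qed.

Lemma filterlim_Rplus (u v : nat -> R) (a b : R) :
  filterlim u U (locally a) -> filterlim v U (locally b) ->
  filterlim (fun n => u n + v n) U (locally (a + b)).
Proof. intros Hu Hv. exact (filterlim_comp_2 u v Rplus Hu Hv (filterlim_plus a b)). Qed.

Lemma filterlim_Rmult (u v : nat -> R) (a b : R) :
  filterlim u U (locally a) -> filterlim v U (locally b) ->
  filterlim (fun n => u n * v n) U (locally (a * b)).
Proof. intros Hu Hv. exact (filterlim_comp_2 u v Rmult Hu Hv (filterlim_mult a b)). Qed.

Lemma filterlim_Rminus (u v : nat -> R) (a b : R) :
  filterlim u U (locally a) -> filterlim v U (locally b) ->
  filterlim (fun n => u n - v n) U (locally (a - b)).
Proof.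
  intros Hu Hv. apply filterlim_Rplus; [assumption|].
  exact (filterlim_comp _ _ _ v Ropp _ _ _ Hv (filterlim_opp b)).
Qed.

Lemma filterlim_Rabs (u : nat -> R) (a : R) :
  filterlim u U (locally a) -> filterlim (fun n => Rabs (u n)) U (locally (Rabs a)).
Proof. intros Hu. exact (filterlim_comp _ _ _ u Rabs _ _ _ Hu (filterlim_norm a)). Qed.

Lemma filterlim_Rle (u v : nat -> R) (a b : R) :
  U (fun n => u n <= v n) ->
  filterlim u U (locally a) -> filterlim v U (locally b) -> a <= b.
Proof. intros H Hu Hv. exact (filterlim_le u v (Finite a) (Finite b) H Hu Hv). Qed.

Lemma filterlim_wsum m w (u : nat -> nat -> R) (f : nat -> R) :
  (forall k, filterlim (fun n => u n k) U (locally (f k))) ->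
  filterlim (fun n => wsum m w (u n)) U (locally (wsum m w f)).
Proof.
  intros Hu.
  assert (Hk : forall k, filterlim (fun n => w k * u n k) U (locally (w k * f k))).
  { intros k. apply filterlim_Rmult; [apply filterlim_const|apply Hu]. }
  induction m as [|m IH]; [apply Hk|].
  rewrite wsum_S. apply filterlim_Rplus; [apply IH|apply Hk].
Qed.

Lemma filterlim_lap (u : nat -> nat -> R) (a : nat -> R) j :
  (forall i, filterlim (fun n => u n i) U (locally (a i))) ->
  filterlim (fun n => lap (u n) j) U (locally (lap a j)).
Proof.
  intros Hu.
  assert (H2 : forall i, filterlim (fun n => 2 * u n i) U (locally (2 * a i))).
  { intros i. apply filterlim_Rmult; [apply filterlim_const|apply Hu]. }
  destruct j as [|i]; simpl.
  - now apply filterlim_Rminus.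
  - apply filterlim_Rplus; [now apply filterlim_Rminus|apply Hu].
Qed.

End FilterLimits.

(** * The truncated Euler scheme *)

(** The cut at [n] removes both boundary terms of [wsum_lap], so partial sums up to [n] obey exact
    identities. Entries above [n] keep their initial values under [euler_step]. *)
Definition flux (K : nat -> nat -> R) (n : nat) (f : nat -> R) (j : nat) : R :=
  if Nat.ltb j n then f j * wsum n (K j) f else 0.

Definition euler_step (K : nat -> nat -> R) (n : nat) (h : R) (f : nat -> R) (j : nat) : R :=
  f j + h * lap (flux K n f) j.

Lemma exists_small (c eps : R) : 0 <= c -> 0 < eps -> exists d, 0 < d /\ c * d <= eps.
Proof.
  intros Hc Heps. exists (eps / (c + 1)). split; [apply Rdiv_lt_0_compat; lra|].
  apply Rmult_le_reg_r with (c + 1); [lra|].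
  replace (c * (eps / (c + 1)) * (c + 1)) with (c * eps) by (field; lra). nra.
Qed.

(** * Estimates for a single Euler step *)

Section Scheme.

Variables (K : nat -> nat -> R) (C : R).
Hypotheses (K_nonneg : forall j k, 0 <= K j k) (C_pos : 0 < C)
  (K_bound : forall j k, K j k <= C * INR j ^ 2 * INR k ^ 2).

Lemma rate_bounds n f j :
  (forall k, 0 <= f k) -> 0 <= wsum n (K j) f <= C * sq j * wsum n sq f.
Proof.
  intros Hf. split; [now apply wsum_nonneg|].
  rewrite <- wsum_scal. apply wsum_le; [assumption|]. intros k. apply K_bound.
Qed.

Lemma flux_bounds n f j :
  (forall k, 0 <= f k) -> 0 <= flux K n f j <= C * wsum n sq f * (sq j * f j).
Proof.
  intros Hf. pose proof (rate_bounds n f j Hf) as [H1 H2].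
  pose proof (wsum_nonneg n sq f Hf sq_nonneg). pose proof (sq_nonneg j).
  specialize (Hf j). unfold flux. destruct (Nat.ltb j n).
  - split; [nra|].
    replace (C * wsum n sq f * (sq j * f j)) with (f j * (C * sq j * wsum n sq f)) by ring.
    now apply Rmult_le_compat_l.
  - split; [lra|]. apply Rmult_le_pos; apply Rmult_le_pos; lra.
Qed.

Lemma flux_0 n f : (forall k, 0 <= f k) -> flux K n f 0 = 0.
Proof.
  intros Hf. pose proof (flux_bounds n f 0 Hf) as H. unfold sq in H at 2. simpl in H. lra.
Qed.

Lemma wsum_euler_step n h w f :
  wsum n w (euler_step K n h f) = wsum n w f + h * wsum n (lap w) (flux K n f).
Proof.
  unfold euler_step. rewrite wsum_add_r, wsum_lap.
  unfold flux at 2 3. rewrite !(proj2 (Nat.ltb_ge _ _)) by lia. ring.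
Qed.

(** The flux bound supplies the factor [sq j], which the condition on [w] absorbs. Taking [w = sq]
    gives the quadratic growth of the second moment; taking a [cutoff] gives a linear Gronwall
    inequality. *)
Lemma wsum_lap_flux_le n w f c :
  (forall k, 0 <= f k) -> (forall k, 0 <= w k) -> 0 <= c ->
  (forall j, (1 <= j)%nat -> sq j * lap w j <= c * w j) ->
  wsum n (lap w) (flux K n f) <= c * C * wsum n sq f * wsum n w f.
Proof.
  intros Hf Hw Hc Hlap. rewrite <- wsum_scal. apply sum_Rle. intros j _.
  pose proof (flux_bounds n f j Hf) as [H1 H2].
  pose proof (wsum_nonneg n sq f Hf sq_nonneg) as HS.
  assert (Hr : 0 <= C * wsum n sq f) by (apply Rmult_le_pos; lra).
  replace (c * C * wsum n sq f * w j * f j)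
    with (C * wsum n sq f * f j * (c * w j)) by ring.
  pose proof (Rmult_le_pos _ _ Hr (Hf j)) as Hr'.
  pose proof (Rmult_le_pos _ _ Hr' (Rmult_le_pos _ _ Hc (Hw j))).
  destruct j as [|i].
  - rewrite flux_0 by assumption. lra.
  - specialize (Hlap (S i) ltac:(lia)).
    (* The upper flux bound may be inserted only where [lap w] is positive; elsewhere the term is
       non-positive because the flux is non-negative. *)
    destruct (Rle_lt_dec (lap w (S i)) 0) as [Hneg|Hpos]; [nra|].
    apply Rle_trans with (lap w (S i) * (C * wsum n sq f * (sq (S i) * f (S i)))).
    + apply Rmult_le_compat_l; lra.
    + apply (Rmult_le_compat_l _ _ _ Hr') in Hlap. lra.
Qed.

Lemma wsum_euler_step_harmonic n h w f :
  (forall k, 0 <= f k) -> (forall j, (1 <= j)%nat -> lap w j = 0) ->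
  wsum n w (euler_step K n h f) = wsum n w f.
Proof.
  intros Hf Hw. rewrite wsum_euler_step.
  replace (wsum n (lap w) (flux K n f)) with 0; [ring|].
  symmetry. apply sum_eq_R0. intros [|j] _.
  - rewrite flux_0 by assumption. ring.
  - rewrite Hw by lia. ring.
Qed.

(** The only loss of entry [j] is [2 * h * flux j], that is [f j] times a factor at most
    [h * (2 * C * sq n * B)]; the neighbouring fluxes are gains. *)
Lemma euler_step_nonneg n h f B :
  (forall k, 0 <= f k) -> wsum n sq f <= B -> 0 <= h ->
  h * (2 * C * sq n * B) <= 1 -> forall j, 0 <= euler_step K n h f j.
Proof.
  intros Hf HB Hh Hstep j.
  assert (Hj : 2 * h * flux K n f j <= f j).
  { unfold flux. destruct (Nat.ltb j n) eqn:E; [|specialize (Hf j); lra].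
    apply Nat.ltb_lt in E. pose proof (rate_bounds n f j Hf) as [H1 H2].
    assert (Hsq : sq j <= sq n).
    { apply pow_incr. split; [apply pos_INR|apply le_INR; lia]. }
    pose proof (wsum_nonneg n sq f Hf sq_nonneg) as HS. pose proof (sq_nonneg j).
    assert (H3 : C * sq j * wsum n sq f <= C * sq n * B).
    { apply Rmult_le_compat; try lra; [apply Rmult_le_pos; lra|].
      apply Rmult_le_compat_l; lra. }
    assert (H4 : h * wsum n (K j) f <= h * (C * sq n * B))
      by (apply Rmult_le_compat_l; lra).
    specialize (Hf j). nra. }
  unfold euler_step.
  assert (Hl : - (2 * flux K n f j) <= lap (flux K n f) j).
  { pose proof (fun i => proj1 (flux_bounds n f i Hf)) as Hp. destruct j as [|i]; simpl.
    - specialize (Hp 1%nat). lra.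
    - pose proof (Hp i). pose proof (Hp (S (S i))). lra. }
  apply (Rmult_le_compat_l h) in Hl; [|assumption]. lra.
Qed.

(** Each flux is at most [C * B] times one term of the second moment, hence at most [C * B * B] for
    all [n] and [j]. This yields the Lipschitz constant in time. *)
Lemma lap_flux_bound n f B :
  (forall k, 0 <= f k) -> wsum n sq f <= B ->
  forall j, Rabs (lap (flux K n f) j) <= 2 * (C * B * B).
Proof.
  intros Hf HB j.
  assert (Hb : forall i, 0 <= flux K n f i <= C * B * B).
  { intros i. pose proof (flux_bounds n f i Hf) as [H1 H2]. split; [assumption|].
    pose proof (wsum_nonneg n sq f Hf sq_nonneg) as HS.
    unfold flux in *. destruct (Nat.ltb i n) eqn:E.
    - apply Nat.ltb_lt in E. eapply Rle_trans; [exact H2|].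
      pose proof (wsum_term_le n sq f i Hf sq_nonneg ltac:(lia)).
      pose proof (Rmult_le_pos _ _ (sq_nonneg i) (Hf i)).
      apply Rmult_le_compat; [apply Rmult_le_pos| | |]; try lra.
      apply Rmult_le_compat_l; lra.
    - apply Rmult_le_pos; [apply Rmult_le_pos|]; lra. }
  apply Rabs_le. destruct j as [|i]; simpl.
  - pose proof (Hb 0%nat). pose proof (Hb 1%nat). lra.
  - pose proof (Hb i). pose proof (Hb (S i)). pose proof (Hb (S (S i))). lra.
Qed.

(** * A priori bounds uniform in the truncation *)

Variables (f0 : nat -> R) (T : R).
Hypotheses (f0_Y2 : Y2plus f0) (M2_pos : 0 < M 2 f0) (T_pos : 0 < T)
  (T_lt : T < / (2 * M 2 f0 * C)).

(* The solution of [y' = 2 C y^2], [y 0 = M 2 f0], which majorizes the second moment. *)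
Definition M2_majorant (t : R) : R := M 2 f0 / (1 - 2 * M 2 f0 * C * t).

Let B := M2_majorant T.

(* The flux rates of the [n]-th scheme are at most [C * n^2 * B], so this step keeps the
   scheme non-negative. *)
Definition mesh (n : nat) : R := / (2 * C * sq (S n) * B).

Definition approx (n i : nat) : nat -> R := Nat.iter i (euler_step K n (mesh n)) f0.

Lemma majorant_denom_pos t : t <= T -> 0 < 1 - 2 * M 2 f0 * C * t.
Proof.
  intros Ht. assert (Hc : 0 < 2 * M 2 f0 * C) by (apply Rmult_lt_0_compat; lra).
  apply Rle_lt_trans with (r1 := t) in T_lt; [|assumption].
  apply (Rmult_lt_compat_l _ _ _ Hc) in T_lt. rewrite Rinv_r in T_lt by lra. lra.
Qed.

Lemma M2_majorant_pos t : t <= T -> 0 < M2_majorant t.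
Proof.
  intros Ht. apply Rdiv_lt_0_compat; [assumption|]. now apply majorant_denom_pos.
Qed.

Lemma M2_majorant_le t : 0 <= t <= T -> M2_majorant t <= B.
Proof.
  intros [H1 H2]. apply Rmult_le_compat_l; [lra|].
  assert (Hc : 0 < 2 * M 2 f0 * C) by (apply Rmult_lt_0_compat; lra).
  apply Rinv_le_contravar; [apply majorant_denom_pos; lra|]. nra.
Qed.

(** A tangent step from a point on a convex solution stays below the solution. With [d] the
    denominator at [t] and [e] its decrease, the claim reduces to [(d + e) * (d - e) <= d * d]. *)
Lemma M2_majorant_step t h :
  0 <= h -> t + h <= T ->
  M2_majorant t + 2 * h * C * M2_majorant t ^ 2 <= M2_majorant (t + h).
Proof.
  intros Hh Ht. pose proof (majorant_denom_pos t ltac:(lra)) as H1.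
  pose proof (majorant_denom_pos (t + h) Ht) as H2. unfold M2_majorant.
  set (m := M 2 f0) in *. set (d := 1 - 2 * m * C * t) in *.
  replace (1 - 2 * m * C * (t + h)) with (d - 2 * m * C * h) in * by (unfold d; ring).
  assert (He : 0 <= 2 * m * C * h)
    by (apply Rmult_le_pos; [left; apply Rmult_lt_0_compat; lra|assumption]).
  set (e := 2 * m * C * h) in *.
  replace (m / d + 2 * h * C * (m / d) ^ 2) with (m * ((d + e) / (d * d)))
    by (unfold e; field; lra).
  apply Rmult_le_compat_l; [lra|].
  apply Rmult_le_reg_r with (d * d * (d - e)); [repeat (apply Rmult_lt_0_compat; [|lra]); lra|].
  replace ((d + e) / (d * d) * (d * d * (d - e))) with ((d + e) * (d - e)) by (field; lra).
  replace (/ (d - e) * (d * d * (d - e))) with (d * d) by (field; lra). nra.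
Qed.

Lemma B_pos : 0 < B.
Proof. apply M2_majorant_pos, Rle_refl. Qed.

Lemma mesh_pos n : 0 < mesh n.
Proof.
  pose proof B_pos. pose proof (sq_ge_1 (S n) ltac:(lia)).
  apply Rinv_0_lt_compat. repeat (apply Rmult_lt_0_compat; [|lra]); lra.
Qed.

Lemma mesh_stable n : mesh n * (2 * C * sq n * B) <= 1.
Proof.
  pose proof B_pos. pose proof (sq_ge_1 (S n) ltac:(lia)).
  apply Rle_trans with (mesh n * (2 * C * sq (S n) * B)).
  - apply Rmult_le_compat_l; [left; apply mesh_pos|].
    apply Rmult_le_compat_r; [lra|]. apply Rmult_le_compat_l; [lra|].
    apply pow_incr. split; [apply pos_INR|apply le_INR; lia].
  - unfold mesh. rewrite Rinv_l; [lra|]. apply Rgt_not_eq.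
    repeat (apply Rmult_lt_0_compat; [|lra]); lra.
Qed.

Lemma mesh_small d : 0 < d -> eventually (fun n => mesh n < d).
Proof.
  intros Hd. pose proof B_pos.
  destruct (INR_unbounded (/ (2 * C * B * d))) as [N HN]. exists N. intros n Hn.
  apply le_INR in Hn. assert (Hc : 0 < 2 * C * B)
    by (repeat (apply Rmult_lt_0_compat; [|lra]); lra).
  assert (Hcd : 0 < 2 * C * B * d) by now apply Rmult_lt_0_compat.
  assert (Hs : / (2 * C * B * d) < sq (S n)).
  { unfold sq. rewrite S_INR. pose proof (pos_INR n). nra. }
  apply (Rmult_lt_compat_l _ _ _ Hcd) in Hs. rewrite Rinv_r in Hs by lra.
  assert (Hp : 0 < 2 * C * sq (S n) * B).
  { pose proof (sq_ge_1 (S n) ltac:(lia)). repeat (apply Rmult_lt_0_compat; [|lra]); lra. }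
  apply Rmult_lt_reg_l with (2 * C * sq (S n) * B); [assumption|].
  unfold mesh. rewrite Rinv_r by lra. lra.
Qed.

(** The two claims need a joint induction: the step preserves signs only under the moment bound, and
    the moment estimate needs non-negative entries. *)
Lemma approx_invariant n i :
  INR i * mesh n <= T ->
  (forall j, 0 <= approx n i j) /\
  wsum n sq (approx n i) <= M2_majorant (INR i * mesh n).
Proof.
  pose proof (mesh_pos n) as Hh. induction i as [|i IH]; intros Hi.
  - destruct f0_Y2 as [Hf Hex]. split; [assumption|].
    simpl. unfold M2_majorant. rewrite Rmult_0_l, Rmult_0_r, Rminus_0_r, Rdiv_1_r.
    apply (wsum_le_Series n sq f0 Hf sq_nonneg Hex).
  - rewrite S_INR in *. replace ((INR i + 1) * mesh n) with (INR i * mesh n + mesh n) in * by ring.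
    destruct IH as [Hf HM]; [lra|].
    assert (Ht : 0 <= INR i * mesh n) by (apply Rmult_le_pos; [apply pos_INR|lra]).
    split.
    + apply (euler_step_nonneg n (mesh n) (approx n i) B); try assumption.
      * eapply Rle_trans; [exact HM|]. apply M2_majorant_le. lra.
      * lra.
      * apply mesh_stable.
    + change (approx n (S i)) with (euler_step K n (mesh n) (approx n i)).
      rewrite wsum_euler_step.
      assert (H2 : wsum n (lap sq) (flux K n (approx n i))
        <= 2 * C * wsum n sq (approx n i) * wsum n sq (approx n i)).
      { apply wsum_lap_flux_le; try assumption; [apply sq_nonneg|lra|].
        (* The second difference of [k^2] is 2, the origin of the 2 in the bound on the lifespan. *)
        intros [|j] Hj; [lia|]. apply Req_le. unfold lap, sq. rewrite !S_INR. ring. }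
      pose proof (wsum_nonneg n sq _ Hf sq_nonneg) as HS.
      eapply Rle_trans; [|apply M2_majorant_step; lra].
      set (x := wsum n sq (approx n i)) in *. set (y := M2_majorant (INR i * mesh n)) in *.
      apply (Rmult_le_compat_l (mesh n)) in H2; [|lra].
      assert (Hxy : x * x <= y * y) by (apply Rmult_le_compat; lra).
      apply (Rmult_le_compat_l (2 * mesh n * C)) in Hxy; [|apply Rmult_le_pos; lra]. lra.
Qed.

Lemma approx_nonneg n i j : INR i * mesh n <= T -> 0 <= approx n i j.
Proof. intros Hi. now apply approx_invariant. Qed.

Lemma approx_M2_le n i : INR i * mesh n <= T -> wsum n sq (approx n i) <= B.
Proof.
  intros Hi. eapply Rle_trans; [now apply approx_invariant|]. apply M2_majorant_le.
  split; [|assumption]. apply Rmult_le_pos; [apply pos_INR|left; apply mesh_pos].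
Qed.

Lemma approx_index_le n i i' : (i <= i')%nat -> INR i' * mesh n <= T -> INR i * mesh n <= T.
Proof.
  intros Hi. apply le_INR in Hi. apply (Rmult_le_compat_r (mesh n)) in Hi.
  - lra.
  - left; apply mesh_pos.
Qed.

Lemma approx_harmonic n i w :
  INR i * mesh n <= T -> (forall j, (1 <= j)%nat -> lap w j = 0) ->
  wsum n w (approx n i) = wsum n w f0.
Proof.
  intros Hi Hw. induction i as [|i IH]; [reflexivity|].
  assert (Hi' : INR i * mesh n <= T) by (apply (approx_index_le n i (S i)); [lia|assumption]).
  change (approx n (S i)) with (euler_step K n (mesh n) (approx n i)).
  rewrite wsum_euler_step_harmonic; [now apply IH| |assumption].
  intros k. now apply approx_nonneg.
Qed.

(** Used with [r = 0] for the Lipschitz bound, and with [r] the flux Laplacian at a reference time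
    for the derivative of the limit. *)
Lemma approx_increment n i d j r e :
  INR (i + d) * mesh n <= T ->
  (forall p, (i <= p < i + d)%nat -> Rabs (lap (flux K n (approx n p)) j - r) <= e) ->
  Rabs (approx n (i + d) j - approx n i j - INR d * mesh n * r) <= INR d * mesh n * e.
Proof.
  intros Hi Hp. induction d as [|d IH].
  - rewrite Nat.add_0_r. simpl INR. rewrite !Rmult_0_l, Rminus_diag, Rminus_0_r, Rabs_R0. lra.
  - specialize (IH (approx_index_le n (i + d) (i + S d) ltac:(lia) Hi)).
    specialize (IH (fun p H => Hp p ltac:(lia))). specialize (Hp (i + d)%nat ltac:(lia)).
    rewrite Nat.add_succ_r in *. pose proof (mesh_pos n) as Hh.
    change (approx n (S (i + d)) j)
      with (approx n (i + d) j + mesh n * lap (flux K n (approx n (i + d))) j).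
    rewrite S_INR.
    replace (approx n (i + d) j + mesh n * lap (flux K n (approx n (i + d))) j
       - approx n i j - (INR d + 1) * mesh n * r)
      with ((approx n (i + d) j - approx n i j - INR d * mesh n * r)
        + mesh n * (lap (flux K n (approx n (i + d))) j - r)) by ring.
    eapply Rle_trans; [apply Rabs_triang|].
    rewrite (Rabs_mult (mesh n)), (Rabs_pos_eq (mesh n)) by lra. nra.
Qed.

Lemma approx_lipschitz n i i' j :
  INR i * mesh n <= T -> INR i' * mesh n <= T ->
  Rabs (approx n i j - approx n i' j)
    <= 2 * (C * B * B) * Rabs (INR i * mesh n - INR i' * mesh n).
Proof.
  assert (Hle : forall i d, INR (i + d) * mesh n <= T ->
    Rabs (approx n (i + d) j - approx n i j)
      <= 2 * (C * B * B) * Rabs (INR (i + d) * mesh n - INR i * mesh n)).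
  { intros p d Hd. pose proof (mesh_pos n).
    pose proof (approx_increment n p d j 0 (2 * (C * B * B)) Hd) as H1.
    rewrite Rmult_0_r, Rminus_0_r in H1.
    rewrite plus_INR.
    replace ((INR p + INR d) * mesh n - INR p * mesh n) with (INR d * mesh n) by ring.
    rewrite (Rabs_pos_eq (INR d * mesh n)) by (apply Rmult_le_pos; [apply pos_INR|lra]).
    rewrite Rmult_comm. apply H1. intros q Hq. rewrite Rminus_0_r.
    assert (Hq' : INR q * mesh n <= T) by (apply (approx_index_le n q (p + d)); [lia|assumption]).
    apply lap_flux_bound; [intros k; now apply approx_nonneg|now apply approx_M2_le]. }
  intros Hi Hi'. destruct (Nat.le_ge_cases i i') as [Hc|Hc].
  - rewrite Rabs_minus_sym, (Rabs_minus_sym (INR i * mesh n)).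
    replace i' with (i + (i' - i))%nat in * by lia. now apply Hle.
  - replace i with (i' + (i - i'))%nat in * by lia. now apply Hle.
Qed.

(** Discrete Gronwall argument: a step multiplies the weighted sum by at most
    [1 + 6 * C * B * mesh n], which is bounded by the exponential. *)
Lemma approx_cutoff_le n i m : (1 <= m)%nat ->
  INR i * mesh n <= T ->
  wsum n (cutoff m) (approx n i) <= exp (6 * C * B * (INR i * mesh n)) * wsum n (cutoff m) f0.
Proof.
  intros Hm. induction i as [|i IH]; intros Hi.
  - simpl. rewrite Rmult_0_l, Rmult_0_r, exp_0. lra.
  - assert (Hi' : INR i * mesh n <= T) by (apply (approx_index_le n i (S i)); [lia|assumption]).
    specialize (IH Hi'). pose proof (mesh_pos n) as Hh. pose proof B_pos as HB.
    assert (Hf : forall k, 0 <= approx n i k) by (intros k; now apply approx_nonneg).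
    change (approx n (S i)) with (euler_step K n (mesh n) (approx n i)).
    rewrite wsum_euler_step.
    assert (HG : 0 <= wsum n (cutoff m) (approx n i))
      by (apply wsum_nonneg; [assumption|intros; now apply cutoff_nonneg]).
    assert (H1 : wsum n (lap (cutoff m)) (flux K n (approx n i))
        <= 6 * C * B * wsum n (cutoff m) (approx n i)).
    { eapply Rle_trans.
      - apply (wsum_lap_flux_le n (cutoff m) (approx n i) 6); try assumption; [|lra|].
        + intros; now apply cutoff_nonneg.
        + intros j Hj. now apply sq_lap_cutoff_le.
      - apply Rmult_le_compat_r; [assumption|]. apply Rmult_le_compat_l; [lra|].
        now apply approx_M2_le. }
    rewrite S_INR.
    replace (6 * C * B * ((INR i + 1) * mesh n))
      with (6 * C * B * mesh n + 6 * C * B * (INR i * mesh n)) by ring.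
    rewrite exp_plus, Rmult_assoc.
    apply Rle_trans with ((1 + 6 * C * B * mesh n) * wsum n (cutoff m) (approx n i)).
    + apply (Rmult_le_compat_l (mesh n)) in H1; [|lra]. lra.
    + apply Rmult_le_compat; try assumption; [|apply exp_ineq1_le].
      assert (0 <= 6 * C * B * mesh n) by (repeat (apply Rmult_le_pos; [|lra]); lra). lra.
Qed.

Lemma approx_tail_small eps : 0 < eps ->
  exists m, forall n i, INR i * mesh n <= T ->
    wsum n (tail_sq m) (approx n i) <= eps.
Proof.
  intros Heps. pose proof B_pos as HB. pose proof (exp_pos (6 * C * B * T)) as Hexp.
  destruct (cutoff_wsum_small f0 f0_Y2 (eps / exp (6 * C * B * T))) as [m [Hm Hsmall]].
  { now apply Rdiv_lt_0_compat. }
  exists m. intros n i Hi.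
  apply Rle_trans with (wsum n (cutoff m) (approx n i)).
  - apply wsum_le; [intros; now apply approx_nonneg|]. intros k. now apply tail_sq_le_cutoff.
  - eapply Rle_trans; [now apply approx_cutoff_le|].
    apply Rle_trans with (exp (6 * C * B * T) * (eps / exp (6 * C * B * T))).
    + apply Rmult_le_compat.
      * left; apply exp_pos.
      * apply wsum_nonneg; [apply f0_Y2|intros; now apply cutoff_nonneg].
      * assert (H : 6 * C * B * (INR i * mesh n) <= 6 * C * B * T)
          by (apply Rmult_le_compat_l; [repeat (apply Rmult_le_pos; [|lra]); lra|assumption]).
        destruct H as [H|H]; [left; now apply exp_increasing|rewrite H; apply Rle_refl].
      * apply Hsmall.
    + apply Req_le. field. lra.
Qed.

(** The rate is split at [m]: its tail is uniformly small, and its head is a fixed finite sum of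
    Lipschitz entries. *)
Lemma flux_equicontinuous j eps : 0 < eps ->
  exists d N, 0 < d /\ forall n i i', (N <= n)%nat ->
    INR i * mesh n <= T -> INR i' * mesh n <= T ->
    Rabs (INR i * mesh n - INR i' * mesh n) <= d ->
    Rabs (flux K n (approx n i) j - flux K n (approx n i') j) <= eps.
Proof.
  intros Heps. pose proof B_pos as HB. pose proof (sq_nonneg j) as Hsj.
  destruct j as [|j0].
  (* Index 0 is separate because the later bound [approx n i' j <= B] relies on [1 <= sq j]. *)
  { exists 1, O. split; [lra|]. intros n i i' _ Hi Hi' _.
    rewrite !flux_0 by (intros; now apply approx_nonneg). rewrite Rminus_diag, Rabs_R0. lra. }
  set (j := S j0) in *. set (P := C * sq j).
  assert (HP : 0 <= P) by (apply Rmult_le_pos; lra).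
  (* The final error is [2 * B * P * e1], from the two tails, plus [L * d * (P * B + B * s)], from
     the Lipschitz bounds; each gets [eps / 2]. The second is settled later, since [s] depends on
     [m] and thus on [e1]. *)
  destruct (exists_small (2 * B * P) (eps / 2)) as [e1 [He1 He1']]; [nra|lra|].
  destruct (approx_tail_small e1 He1) as [m Hm].
  set (L := 2 * (C * B * B)).
  assert (HL : 0 <= L).
  { unfold L. apply Rmult_le_pos; [lra|]. repeat (apply Rmult_le_pos; [|lra]); lra. }
  set (s := sum_f_R0 (K j) m).
  assert (Hs : 0 <= s) by (apply cond_pos_sum; intros; apply K_nonneg).
  destruct (exists_small (L * (P * B + B * s)) (eps / 2)) as [d [Hd Hd']].
  { apply Rmult_le_pos; [assumption|]. nra. }
  { lra. }
  exists d, (S (max j m)). split; [assumption|]. intros n i i' Hn Hi Hi' Hii.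
  assert (Hf : forall k, 0 <= approx n i k) by (intros; now apply approx_nonneg).
  assert (Hf' : forall k, 0 <= approx n i' k) by (intros; now apply approx_nonneg).
  assert (Hlip : forall k, Rabs (approx n i k - approx n i' k) <= L * d).
  { intros k. eapply Rle_trans; [now apply approx_lipschitz|]. now apply Rmult_le_compat_l. }
  unfold flux. rewrite (proj2 (Nat.ltb_lt j n)) by lia.
  assert (HA : 0 <= wsum n (K j) (approx n i) <= P * B).
  { pose proof (rate_bounds n (approx n i) j Hf) as [H1 H2]. split; [assumption|].
    eapply Rle_trans; [exact H2|]. apply Rmult_le_compat_l; [assumption|].
    now apply approx_M2_le. }
  assert (Hfj : approx n i' j <= B).
  { apply Rle_trans with (sq j * approx n i' j).
    - pose proof (sq_ge_1 j ltac:(lia)). specialize (Hf' j). nra.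
    - eapply Rle_trans; [apply (wsum_term_le n sq); [assumption|apply sq_nonneg|lia]|].
      now apply approx_M2_le. }
  assert (Htail : forall p, INR p * mesh n <= T ->
    Rabs (wsum n (K j) (approx n p) - wsum m (K j) (approx n p)) <= P * e1).
  { intros p Hp. eapply Rle_trans.
    - apply (wsum_tail_le m n (K j) (approx n p) P); try assumption; [lia| |].
      + intros; now apply approx_nonneg.
      + intros k _. split; [apply K_nonneg|apply K_bound].
    - apply Rmult_le_compat_l; [assumption|]. now apply Hm. }
  assert (HAA : Rabs (wsum n (K j) (approx n i) - wsum n (K j) (approx n i'))
    <= 2 * P * e1 + L * d * s).
  { pose proof (Htail i Hi) as H1. pose proof (Htail i' Hi') as H2.
    pose proof (wsum_dist m (K j) (approx n i) (approx n i') (L * d)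
      (K_nonneg j) (fun k _ => Hlip k)) as H3. fold s in H3.
    apply Rabs_le_between in H1, H2, H3. apply Rabs_le. lra. }
  specialize (Hlip j). pose proof (Hf' j).
  set (a := wsum n (K j) (approx n i)) in *. set (a' := wsum n (K j) (approx n i')) in *.
  set (x := approx n i j) in *. set (x' := approx n i' j) in *.
  replace (x * a - x' * a') with ((x - x') * a + x' * (a - a')) by ring.
  eapply Rle_trans; [apply Rabs_triang|]. rewrite !Rabs_mult.
  rewrite (Rabs_pos_eq a), (Rabs_pos_eq x') by lra.
  assert (H1 : Rabs (x - x') * a <= L * d * (P * B))
    by (apply Rmult_le_compat; try lra; apply Rabs_pos).
  assert (H2 : x' * Rabs (a - a') <= B * (2 * P * e1 + L * d * s))
    by (apply Rmult_le_compat; try lra; apply Rabs_pos).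
  lra.
Qed.

(** * Passage to the limit *)

Definition step_index (n : nat) (t : R) : nat := Z.to_nat (Int_part (t / mesh n)).

Definition approx_at (n : nat) (t : R) : nat -> R := approx n (step_index n t).

Lemma step_index_spec n t : 0 <= t ->
  INR (step_index n t) * mesh n <= t < INR (step_index n t) * mesh n + mesh n.
Proof.
  intros Ht. pose proof (mesh_pos n) as Hh.
  assert (Hq : 0 <= t / mesh n) by now apply Rdiv_le_0_compat.
  destruct (base_Int_part (t / mesh n)) as [H1 H2].
  assert (H0 : (0 <= Int_part (t / mesh n))%Z).
  { apply Z.lt_succ_r, lt_IZR. rewrite succ_IZR. lra. }
  unfold step_index. rewrite INR_IZR_INZ, Z2Nat.id by assumption.
  set (q := t / mesh n) in *. replace t with (q * mesh n) by (unfold q; field; lra).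
  split; nra.
Qed.

Lemma step_index_le_T n t : 0 <= t <= T -> INR (step_index n t) * mesh n <= T.
Proof. intros [H1 H2]. pose proof (step_index_spec n t H1). lra. Qed.

Lemma step_index_mono n s t : 0 <= s <= t -> (step_index n s <= step_index n t)%nat.
Proof.
  intros [Hs Hst]. pose proof (mesh_pos n) as Hh.
  pose proof (step_index_spec n s Hs). pose proof (step_index_spec n t ltac:(lra)).
  apply Nat.lt_succ_r, INR_lt. rewrite S_INR.
  apply Rmult_lt_reg_r with (mesh n); lra.
Qed.

Lemma step_index_0 n : step_index n 0 = O.
Proof.
  pose proof (mesh_pos n) as Hh. destruct (step_index_spec n 0 (Rle_refl 0)) as [H _].
  destruct (step_index n 0) as [|k]; [reflexivity|].
  rewrite S_INR in H. pose proof (pos_INR k). nra.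
Qed.

Lemma approx_at_nonneg n t j : 0 <= t <= T -> 0 <= approx_at n t j.
Proof. intros Ht. apply approx_nonneg. now apply step_index_le_T. Qed.

Lemma approx_at_lipschitz n s t j :
  0 <= s <= T -> 0 <= t <= T ->
  Rabs (approx_at n s j - approx_at n t j) <= 2 * (C * B * B) * (Rabs (s - t) + mesh n).
Proof.
  intros Hs Ht. pose proof B_pos as HB. eapply Rle_trans.
  - apply approx_lipschitz; now apply step_index_le_T.
  - apply Rmult_le_compat_l.
    + apply Rmult_le_pos; [lra|]. repeat (apply Rmult_le_pos; [|lra]); lra.
    + pose proof (step_index_spec n s (proj1 Hs)). pose proof (step_index_spec n t (proj1 Ht)).
      pose proof (Rle_abs (s - t)). pose proof (Rle_abs (- (s - t))) as H2.
      rewrite Rabs_Ropp in H2. apply Rabs_le. lra.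
Qed.

(** The filter can settle only countably many sequences, so it is built for rational times capped at
    [T]. The Lipschitz bound, whose error [mesh n] vanishes, carries the Cauchy property to every
    time. *)
Lemma approx_limit :
  exists (U : (nat -> Prop) -> Prop) (f : R -> nat -> R),
    ProperFilter U /\ filter_le U eventually /\
    forall t j, 0 <= t <= T -> filterlim (fun n => approx_at n t j) U (locally (f t j)).
Proof.
  pose proof B_pos as HB. set (L := 2 * (C * B * B)).
  assert (HL : 0 <= L).
  { apply Rmult_le_pos; [lra|]. repeat (apply Rmult_le_pos; [|lra]); lra. }
  set (time := fun a b : nat => Rmin T (INR a / INR (S b))).
  assert (Htime : forall a b, 0 <= time a b <= T).
  { intros a b. split; [|apply Rmin_l]. apply Rmin_glb; [lra|].
    apply Rdiv_le_0_compat; [apply pos_INR|apply lt_0_INR; lia]. }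
  destruct (diagonal_filter (fun c n => let (j, ab) := of_nat c in let (a, b) := of_nat ab in
      approx_at n (time a b) j)) as [U [HU [Hev Hlim]]].
  { intros c. destruct (of_nat c) as [j ab]. destruct (of_nat ab) as [a b].
    exists (f0 j + L * T), O. intros n _. pose proof (Htime a b) as Hab.
    split; [now apply approx_at_nonneg|].
    pose proof (step_index_le_T n _ Hab) as Hi.
    assert (H : Rabs (approx_at n (time a b) j - f0 j) <= L * T).
    { pose proof (mesh_pos n).
      assert (H0 : INR 0 * mesh n <= T) by (simpl; lra).
      eapply Rle_trans; [exact (approx_lipschitz n _ O j Hi H0)|].
      apply Rmult_le_compat_l; [assumption|]. simpl INR at 2. rewrite Rmult_0_l, Rminus_0_r.
      rewrite Rabs_pos_eq; [assumption|]. apply Rmult_le_pos; [apply pos_INR|lra]. }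
    apply Rabs_le_between in H. lra. }
  (* [iota] turns the pointwise existence of limits into a function; its values outside [[0, T]] are
     not specified. *)
  exists U, (fun t j => iota (fun l : R => filterlim (fun n => approx_at n t j) U (locally l))).
  split; [assumption|]. split; [assumption|]. intros t j Ht.
  cut (exists l : R, filterlim (fun n => approx_at n t j) U (locally l)).
  { intros [l Hl].
    exact (eq_ind_r (fun y : R => filterlim (fun n => approx_at n t j) U (locally y)) Hl
      (iota_filterlim_locally (K := R_AbsRing) (V := R_CompleteNormedModule) _ l Hl)). }
  apply (filterlim_locally_cauchy (U := R_CompleteSpace)). intros eps.
  destruct (exists_small (2 * L) (eps / 4)) as [d [Hd Hd']]; [lra|destruct eps; simpl; lra|].
  destruct (INR_unbounded (/ d)) as [b Hb].
  assert (Hb0 : 0 < INR (S b)) by (apply lt_0_INR; lia).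
  assert (Hbd : / INR (S b) <= d).
  { rewrite <- (Rinv_inv d), S_INR. pose proof (Rinv_0_lt_compat _ Hd).
    apply Rinv_le_contravar; lra. }
  destruct (nfloor_ex (t * INR (S b))) as [a Ha]; [apply Rmult_le_pos; lra|].
  assert (Hat : INR a / INR (S b) <= t < INR a / INR (S b) + / INR (S b)).
  { replace t with (t * INR (S b) * / INR (S b)) by (field; lra).
    pose proof (Rinv_0_lt_compat _ Hb0) as Hinv. unfold Rdiv. split; nra. }
  assert (Hst : Rabs (t - time a b) <= d).
  { unfold time. rewrite Rmin_right by lra. apply Rabs_le. lra. }
  destruct (Hlim (to_nat (j, to_nat (a, b)))) as [l Hl]. rewrite !cancel_of_to in Hl.
  assert (He : 0 < eps / 4) by (destruct eps; simpl; lra).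
  pose proof (proj1 (filterlim_R U _ _) Hl _ He) as Hball.
  eexists. split; [exact (filter_and _ _ Hball (Hev _ (mesh_small d Hd)))|].
  assert (Hclose : forall n, Rabs (approx_at n (time a b) j - l) < eps / 4 /\ mesh n < d ->
     Rabs (approx_at n t j - l) < eps / 2).
  { intros n [H1 H2].
    pose proof (approx_at_lipschitz n t (time a b) j Ht (Htime a b)) as H3. fold L in H3.
    assert (H4 : L * (Rabs (t - time a b) + mesh n) <= L * (2 * d))
      by (apply Rmult_le_compat_l; lra).
    replace (approx_at n t j - l) with
      ((approx_at n t j - approx_at n (time a b) j) + (approx_at n (time a b) j - l)) by ring.
    eapply Rle_lt_trans; [apply Rabs_triang|]. lra. }
  intros p q Hp Hq. apply Hclose in Hp, Hq.
  change (Rabs (approx_at q t j - approx_at p t j) < eps).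
  apply Rabs_def2 in Hp, Hq. apply Rabs_def1; lra.
Qed.

Lemma lap_flux_equicontinuous j eps : 0 < eps ->
  exists d N, 0 < d /\ forall n i i', (N <= n)%nat ->
    INR i * mesh n <= T -> INR i' * mesh n <= T ->
    Rabs (INR i * mesh n - INR i' * mesh n) <= d ->
    Rabs (lap (flux K n (approx n i)) j - lap (flux K n (approx n i')) j) <= eps.
Proof.
  intros Heps. assert (He : 0 < eps / 4) by lra.
  (* The coefficients 1, 2, 1 of [lap] account for [eps / 4]; for [j = 0] the index [pred j] merely
     repeats 0. *)
  destruct (flux_equicontinuous (pred j) _ He) as [d1 [N1 [Hd1 H1]]].
  destruct (flux_equicontinuous j _ He) as [d2 [N2 [Hd2 H2]]].
  destruct (flux_equicontinuous (S j) _ He) as [d3 [N3 [Hd3 H3]]].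
  exists (Rmin d1 (Rmin d2 d3)), (max N1 (max N2 N3)).
  split; [repeat apply Rmin_pos; assumption|].
  intros n i i' Hn Hi Hi' Hd.
  pose proof (Rmin_l d1 (Rmin d2 d3)). pose proof (Rmin_r d1 (Rmin d2 d3)).
  pose proof (Rmin_l d2 d3). pose proof (Rmin_r d2 d3).
  specialize (H1 n i i' ltac:(lia) Hi Hi' ltac:(lra)).
  specialize (H2 n i i' ltac:(lia) Hi Hi' ltac:(lra)).
  specialize (H3 n i i' ltac:(lia) Hi Hi' ltac:(lra)).
  apply Rabs_le_between in H1, H2, H3. apply Rabs_le.
  destruct j as [|j]; simpl in *; lra.
Qed.

(** * Moments and differential equation of the limit *)

Variables (U : (nat -> Prop) -> Prop) (f : R -> nat -> R).
Context {U_proper : ProperFilter U}.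
Hypotheses (U_eventually : filter_le U eventually)
  (f_lim : forall t j, 0 <= t <= T ->
     filterlim (fun n => approx_at n t j) U (locally (f t j))).

Lemma limit_0 j : f 0 j = f0 j.
Proof.
  apply (filterlim_locally_unique (F := U) (fun n => approx_at n 0 j)).
  - apply f_lim. lra.
  - apply (filterlim_ext (fun _ => f0 j)); [|apply filterlim_const].
    intros n. unfold approx_at. now rewrite step_index_0.
Qed.

Lemma limit_nonneg t j : 0 <= t <= T -> 0 <= f t j.
Proof.
  intros Ht. apply (filterlim_Rle U (fun _ => 0) (fun n => approx_at n t j)).
  - apply filter_forall. intros n. now apply approx_at_nonneg.
  - apply filterlim_const.
  - now apply f_lim.
Qed.

Lemma limit_Y2 t : 0 <= t <= T -> Y2plus (f t).
Proof.
  intros Ht. split; [intros j; now apply limit_nonneg|].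
  assert (Hbound : forall m, wsum m sq (f t) <= B).
  { intros m. apply (filterlim_Rle U (fun n => wsum m sq (approx_at n t)) (fun _ => B)).
    - apply U_eventually. exists m. intros n Hn. apply Rle_trans with (wsum n sq (approx_at n t)).
      + apply wsum_incr; [assumption| |apply sq_nonneg]. intros; now apply approx_at_nonneg.
      + apply approx_M2_le. now apply step_index_le_T.
    - apply filterlim_wsum; [assumption|]. intros k. now apply f_lim.
    - apply filterlim_const. }
  destruct (ex_finite_lim_seq_incr (fun m => wsum m sq (f t)) B) as [l Hl].
  - intros m. apply wsum_incr; [lia| |apply sq_nonneg]. intros; now apply limit_nonneg.
  - exact Hbound.
  - exists l. apply (is_lim_seq_ext _ (sum_n (fun j => INR j ^ 2 * f t j)) l) in Hl; [exact Hl|].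
    intros m. symmetry. apply sum_n_Reals.
Qed.

(** The range of summation grows with [n], so entrywise convergence alone is not enough. Three
    errors of [eps / 4] arise: the tail of the scheme, the head, and the tail of the limit
    series. *)
Lemma limit_wsum t w c : 0 <= t <= T -> 0 <= c ->
  (forall k, (1 <= k)%nat -> 0 <= w k <= c * sq k) ->
  filterlim (fun n => wsum n w (approx_at n t)) U (locally (Series (fun k => w k * f t k))).
Proof.
  intros Ht Hc Hw. apply filterlim_R; [assumption|]. intros eps Heps.
  destruct (exists_small c (eps / 4)) as [e [He He']]; [assumption|lra|].
  destruct (approx_tail_small e He) as [m1 Hm1].
  pose proof (Series_correct _ (ex_series_wsum w (f t) c (limit_Y2 t Ht) Hw)) as Hser.
  destruct (proj1 (is_series_Reals _ _) Hser (eps / 4)) as [m2 Hm2]; [lra|].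
  set (m := max m1 m2). specialize (Hm2 m ltac:(lia)).
  unfold Rdist in Hm2. fold (wsum m w (f t)) in Hm2.
  pose proof (filterlim_wsum U m w (fun n => approx_at n t) (f t) (fun k => f_lim t k Ht)) as Hfin.
  assert (Heps4 : 0 < eps / 4) by lra.
  pose proof (proj1 (filterlim_R U _ _) Hfin _ Heps4) as HU.
  assert (Hev : U (fun n => (m <= n)%nat)) by (apply U_eventually; now exists m).
  generalize (filter_and _ _ HU Hev). apply filter_imp. intros n [H1 Hn].
  assert (Hf : forall k, 0 <= approx_at n t k) by (intros; now apply approx_at_nonneg).
  pose proof (wsum_tail_le m n w (approx_at n t) c Hn Hf Hc Hw) as H2.
  assert (H3 : wsum n (tail_sq m) (approx_at n t) <= e).
  { apply Rle_trans with (wsum n (tail_sq m1) (approx_at n t)).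
    - apply wsum_le; [assumption|]. intros k. pose proof (sq_nonneg k). unfold tail_sq.
      destruct (Nat.leb m k) eqn:E1, (Nat.leb m1 k) eqn:E2; try lra.
      apply Nat.leb_le in E1. apply Nat.leb_gt in E2. lia.
    - apply Hm1. now apply step_index_le_T. }
  apply (Rmult_le_compat_l c) in H3; [|assumption].
  apply Rabs_le_between in H2. apply Rabs_def2 in H1, Hm2. apply Rabs_def1; lra.
Qed.

Definition limit_flux (t : R) (j : nat) : R := f t j * Series (fun k => K j k * f t k).

Lemma kernel_row_bound j k : 0 <= K j k <= C * sq j * sq k.
Proof. split; [apply K_nonneg|apply K_bound]. Qed.

Lemma C_sq_nonneg j : 0 <= C * sq j.
Proof. apply Rmult_le_pos; [lra|apply sq_nonneg]. Qed.

Lemma limit_flux_lim t j : 0 <= t <= T ->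
  filterlim (fun n => flux K n (approx_at n t) j) U (locally (limit_flux t j)).
Proof.
  intros Ht. apply (filterlim_ext_loc (fun n => approx_at n t j * wsum n (K j) (approx_at n t))).
  - apply U_eventually. exists (S j). intros n Hn. unfold flux.
    now rewrite (proj2 (Nat.ltb_lt j n)) by lia.
  - apply filterlim_Rmult; [assumption|now apply f_lim|].
    apply (limit_wsum t (K j) (C * sq j) Ht (C_sq_nonneg j)).
    intros k _. apply kernel_row_bound.
Qed.

Lemma limit_lap_flux_lim t j : 0 <= t <= T ->
  filterlim (fun n => lap (flux K n (approx_at n t)) j) U (locally (lap (limit_flux t) j)).
Proof. intros Ht. apply filterlim_lap; [assumption|]. intros i. now apply limit_flux_lim. Qed.

(** Equicontinuity of the discrete fluxes gives this estimate for the schemes, and it survives the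
    limit; no integral equation is involved. The reference time [x] may coincide with either end,
    which serves both one-sided difference quotients. *)
Lemma limit_increment j eps : 0 < eps ->
  exists d, 0 < d /\ forall x s t, 0 <= x <= T -> 0 <= s <= T -> 0 <= t <= T -> s <= t ->
    Rabs (s - x) <= d -> Rabs (t - x) <= d ->
    Rabs (f t j - f s j - (t - s) * lap (limit_flux x) j) <= eps * (t - s) /\
    Rabs (lap (limit_flux s) j - lap (limit_flux x) j) <= eps.
Proof.
  intros Heps. destruct (lap_flux_equicontinuous j eps Heps) as [d0 [N [Hd0 Heq]]].
  (* The other half of [d0] absorbs the rounding of times to grid points, which is at most one
     mesh. *)
  assert (Hd : 0 < d0 / 2) by lra. exists (d0 / 2). split; [assumption|].
  intros x s t Hx Hs Ht Hst Hsx Htx.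
  apply Rabs_le_between in Hsx, Htx.
  assert (Hev : U (fun n => (N <= n)%nat /\ mesh n < d0 / 2)).
  { apply filter_and; [apply U_eventually; now exists N|].
    apply U_eventually. now apply mesh_small. }
  split.
  - assert (Hlen : filterlim (fun n => INR (step_index n t - step_index n s) * mesh n) U
      (locally (t - s))).
    { apply filterlim_R; [assumption|]. intros e He.
      generalize (U_eventually _ (mesh_small e He)). apply filter_imp. intros n Hn.
      pose proof (step_index_spec n s (proj1 Hs)). pose proof (step_index_spec n t (proj1 Ht)).
      rewrite minus_INR by (apply step_index_mono; lra). apply Rabs_def1; lra. }
    eapply (filterlim_Rle U
      (fun n => Rabs (approx_at n t j - approx_at n s j
         - INR (step_index n t - step_index n s) * mesh n * lap (flux K n (approx_at n x)) j))
      (fun n => eps * (INR (step_index n t - step_index n s) * mesh n))).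
    + generalize Hev. apply filter_imp. intros n [Hn Hmesh].
      pose proof (step_index_mono n s t ltac:(lra)) as Hmono.
      pose proof (step_index_le_T n t Ht) as HtT.
      unfold approx_at at 1.
      replace (step_index n t) with (step_index n s + (step_index n t - step_index n s))%nat
        at 1 by lia.
      rewrite (Rmult_comm eps). apply approx_increment.
      * now replace (step_index n s + (step_index n t - step_index n s))%nat
          with (step_index n t) by lia.
      * intros p Hp.
        assert (HpT : INR p * mesh n <= T)
          by (apply (approx_index_le n p (step_index n t)); [lia|assumption]).
        apply Heq; [assumption|assumption|now apply step_index_le_T|].
        pose proof (mesh_pos n) as Hh.
        pose proof (step_index_spec n s (proj1 Hs)). pose proof (step_index_spec n t (proj1 Ht)).
        pose proof (step_index_spec n x (proj1 Hx)).
        assert (Hp1 : INR (step_index n s) * mesh n <= INR p * mesh n)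
          by (apply Rmult_le_compat_r; [lra|apply le_INR; lia]).
        assert (Hp2 : INR p * mesh n <= INR (step_index n t) * mesh n)
          by (apply Rmult_le_compat_r; [lra|apply le_INR; lia]).
        apply Rabs_le. lra.
    + apply filterlim_Rabs. apply filterlim_Rminus; [assumption| |].
      * apply filterlim_Rminus; [assumption| |]; now apply f_lim.
      * apply filterlim_Rmult; [assumption|exact Hlen|now apply limit_lap_flux_lim].
    + apply filterlim_Rmult; [assumption|apply filterlim_const|exact Hlen].
  - apply (filterlim_Rle U
      (fun n => Rabs (lap (flux K n (approx_at n s)) j - lap (flux K n (approx_at n x)) j))
      (fun _ => eps)).
    + generalize Hev. apply filter_imp. intros n [Hn Hmesh].
      apply Heq; [assumption|now apply step_index_le_T|now apply step_index_le_T|].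
      pose proof (step_index_spec n s (proj1 Hs)). pose proof (step_index_spec n x (proj1 Hx)).
      apply Rabs_le. lra.
    + apply filterlim_Rabs. apply filterlim_Rminus; [assumption| |]; now apply limit_lap_flux_lim.
    + apply filterlim_const.
Qed.

Lemma limit_is_derive t j : 0 <= t <= T ->
  is_derive_on (fun s => 0 <= s <= T) (fun s => f s j) t (lap (limit_flux t) j).
Proof.
  intros Ht.
  split; [exact (is_linear_scal_l (K := R_AbsRing) (V := R_NormedModule) _)|]. intros x Hx.
  (* [filterdiff] quantifies over all limit points of the filter. Properness, which holds because
     [t] lies in the interval, makes [t] the only one. *)
  assert (HP : ProperFilter (within (fun s => 0 <= s <= T) (locally t))).
  { constructor; [|typeclasses eauto]. intros P HPt. exists t.
    exact (locally_singleton _ _ HPt Ht). }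
  assert (x = t) as ->.
  { apply (is_filter_lim_unique (K := R_AbsRing) (V := R_NormedModule) x t Hx).
    intros P HPt. unfold within. generalize HPt. apply filter_imp. auto. }
  intros eps. destruct (limit_increment j eps (cond_pos eps)) as [d [Hd Hinc]].
  exists (mkposreal d Hd). intros y Hy HyT.
  change (Rabs (y - t) < d) in Hy.
  change (Rabs (f y j - f t j - (y - t) * lap (limit_flux t) j) <= eps * Rabs (y - t)).
  assert (H0 : Rabs (t - t) <= d) by (rewrite Rminus_diag, Rabs_R0; lra).
  destruct (Rle_lt_dec t y) as [Hty|Hty].
  - rewrite (Rabs_pos_eq (y - t)) by lra. apply Hinc; lra.
  - rewrite (Rabs_minus_sym y t), (Rabs_pos_eq (t - y)) by lra.
    rewrite <- Rabs_Ropp.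
    replace (- (f y j - f t j - (y - t) * lap (limit_flux t) j))
      with (f t j - f y j - (t - y) * lap (limit_flux t) j) by ring.
    apply Hinc; lra.
Qed.

Lemma limit_lap_flux_continuous j :
  continuous_on (fun s => 0 <= s <= T) (fun s => lap (limit_flux s) j).
Proof.
  intros t Ht. apply filterlim_locally. intros eps.
  assert (He : 0 < eps / 2) by (destruct eps; simpl; lra).
  destruct (limit_increment j _ He) as [d [Hd Hinc]].
  exists (mkposreal d Hd). intros y Hy HyT. change (Rabs (y - t) < d) in Hy.
  change (Rabs (lap (limit_flux y) j - lap (limit_flux t) j) < eps).
  eapply Rle_lt_trans; [apply (Hinc t y y); lra|]. lra.
Qed.

(** The partial sums [wsum n w f0] have two limits along [U]: being conserved they equal the sums of
    the scheme, which tend to the moment of [f t], and they also converge to the initial moment. *)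
Lemma limit_moment t w : 0 <= t <= T ->
  (forall k, (1 <= k)%nat -> 0 <= w k <= sq k) ->
  (forall j, (1 <= j)%nat -> lap w j = 0) ->
  Series (fun k => w k * f t k) = Series (fun k => w k * f0 k).
Proof.
  intros Ht Hw Hlap.
  assert (Hw1 : forall k, (1 <= k)%nat -> 0 <= w k <= 1 * sq k)
    by (intros k Hk; specialize (Hw k Hk); lra).
  apply (filterlim_locally_unique (F := U) (fun n => wsum n w f0)).
  - apply (filterlim_ext (fun n => wsum n w (approx_at n t))).
    + intros n. apply approx_harmonic; [now apply step_index_le_T|assumption].
    + apply (limit_wsum t w 1 Ht); [lra|assumption].
  - apply (filterlim_filter_le_1 (F := eventually)); [assumption|].
    apply (filterlim_ext (sum_n (fun k => w k * f0 k))); [intros n; apply sum_n_Reals|].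
    exact (Series_correct _ (ex_series_wsum w f0 1 f0_Y2 Hw1)).
Qed.

Lemma limit_summable t : 0 <= t <= T -> (forall j k, K j k = K k j) -> EDG_summable K (f t).
Proof.
  intros Ht Hsym j.
  assert (H : ex_series (fun k => K j k * f t k)).
  { apply (ex_series_wsum _ _ (C * sq j) (limit_Y2 t Ht)). intros k _. apply kernel_row_bound. }
  split; [assumption|].
  apply (ex_series_incr_1 (fun k => K j k * f t k)) in H.
  revert H. apply ex_series_ext. intros k. now rewrite Hsym.
Qed.

Lemma limit_flux_0 t : limit_flux t 0 = 0.
Proof.
  (* The product [0 * 0] lets [Series_scal_l] pull out a factor 0. *)
  unfold limit_flux. rewrite (Series_ext _ (fun _ => 0 * 0)).
  - rewrite Series_scal_l. ring.
  - intros k. pose proof (K_bound 0 k) as H. pose proof (K_nonneg 0 k). simpl in H.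
    replace (K 0%nat k) with 0 by lra. ring.
Qed.

(** Because [K i 0 = 0], the sum over [k >= 1] is by symmetry the full row sum, so all four terms
    are fluxes. At [j = 0] the equation has the flux at 0 once and [lap] has it twice, but that flux
    is 0. *)
Lemma limit_rhs t j : 0 <= t <= T -> (forall j k, K j k = K k j) ->
  EDG_rhs K (f t) j = lap (limit_flux t) j.
Proof.
  intros Ht Hsym.
  assert (Hshift : forall i, Series (fun k => K (S k) i * f t (S k))
    = Series (fun k => K i k * f t k)).
  { intros i. rewrite (Series_incr_1 (fun k => K i k * f t k)) by apply (limit_summable t Ht Hsym).
    pose proof (K_bound i 0) as H. pose proof (K_nonneg i 0). simpl in H.
    replace (K i 0%nat) with 0 by lra. rewrite Rmult_0_l, Rplus_0_l.
    apply Series_ext. intros k. now rewrite Hsym. }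
  destruct j as [|i]; unfold EDG_rhs, lap, limit_flux; rewrite !Hshift; [|ring].
  pose proof (limit_flux_0 t) as H. unfold limit_flux in H. rewrite H. ring.
Qed.

End Scheme.

Theorem theorem2p5
  (K : nat -> nat -> R) (C : R) (f0 : nat -> R)
  (K_nonneg : forall j k, 0 <= K j k)
  (K_sym : forall j k, K j k = K k j)
  (C_pos : 0 < C)
  (K_bound : forall j k, K j k <= C * INR j ^ 2 * INR k ^ 2)
  (f0_Y2 : Y2plus f0)
  (M2_pos : 0 < M 2 f0)
  (T0 : R) (T0_pos : 0 < T0) (T0_lt : T0 < / (2 * M 2 f0 * C)) :
  exists f : R -> nat -> R,
    EDG_C1_solution K f0 T0 f
    /\ (forall t, 0 <= t <= T0 -> Y2plus (f t))
    /\ (forall t, 0 <= t <= T0 -> M 0 (f t) = M 0 f0 /\ M 1 (f t) = M 1 f0).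
Proof.
  destruct (approx_limit K C K_nonneg C_pos K_bound f0 T0 f0_Y2 M2_pos T0_pos T0_lt)
    as [U [f [HU [Hev Hlim]]]].
  assert (Hrhs : forall t j, 0 <= t <= T0 -> EDG_rhs K (f t) j = lap (limit_flux K f t) j).
  { intros t j Ht. eapply limit_rhs with (C := C) (T := T0); eassumption. }
  assert (Hder : forall t j, 0 <= t <= T0 ->
    is_derive_on (fun s => 0 <= s <= T0) (fun s => f s j) t (lap (limit_flux K f t) j)).
  { intros t j Ht. eapply limit_is_derive with (C := C) (T := T0); eassumption. }
  exists f. split; [|split].
  - split; [|split; [|split]].
    + eapply limit_0 with (C := C) (T := T0); eassumption.
    + intros j. exists (fun t => lap (limit_flux K f t) j). split.
      * intros t Ht. now apply Hder.
      * eapply limit_lap_flux_continuous with (C := C) (T := T0); eassumption.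
    + intros t Ht. eapply limit_summable with (C := C) (T := T0); eassumption.
    + intros t j Ht. rewrite Hrhs by assumption. now apply Hder.
  - intros t Ht. eapply limit_Y2 with (C := C) (T := T0); eassumption.
  - intros t Ht. split;
      [eapply limit_moment with (C := C) (T := T0) (w := fun k => INR k ^ 0)
      |eapply limit_moment with (C := C) (T := T0) (w := fun k => INR k ^ 1)];
      try eassumption.
    + intros k Hk. pose proof (sq_ge_1 k Hk). simpl. lra.
    + intros [|j] Hj; [lia|]. simpl. ring.
    + intros k Hk. apply le_INR in Hk. simpl in Hk. unfold sq. split; nra.
    + intros [|j] Hj; [lia|]. unfold lap. rewrite !S_INR. ring.
Qed.
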